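(* Let $a,b\in\mathbb{R}$, not both zero, and let $\alpha^*=\alpha+\lambda B$ be a $B$-$O^*$ associated curve of $\alpha$ (with respect to $a,b$). Put $$X=-\lambda\tau(-\lambda\tau^2+\lambda'')-\lambda'(-\lambda\tau'-2\lambda'\tau+\kappa),\qquad Y=\lambda\tau^2-\lambda''+\lambda'\lambda\tau\kappa.$$ Then, where the denominators below do not vanish, the curvature $\kappa^*$ and the torsion $\tau^*$ of $\alpha^*$ are $$\kappa^*=-\frac{a^4(X\lambda\tau+Y)}{(\lambda')^4\,b\,(a^2+b^2)\sqrt{a^2+b^2}},$$ $$\tau^*=\frac{b^2(\lambda')^2}{a^2(X\lambda\tau+Y)^2}\Big(X\big(\lambda\tau\kappa'+3\lambda'\tau\kappa+2\lambda\tau'\kappa-\kappa^2\big)+Y\big(\lambda\tau^3+\lambda\tau\kappa^2-\lambda\tau''-3\lambda'\tau'-3\lambda''\tau+\kappa'\big)\Big).$$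
   Context: $\alpha$ is a smooth curve in $E^3$ parametrized by arc length $s$, with Frenet frame $\{T,N,B\}$, curvature $\kappa>0$ and torsion $\tau$: $T'=\kappa N$, $N'=-\kappa T+\tau B$, $B'=-\tau N$. For a curve $\alpha^*$ with the same parameter $s$ (regular, not necessarily unit speed, with ${\alpha^*}'\wedge{\alpha^*}''\ne 0$), $T^*={\alpha^*}'/\|{\alpha^*}'\|$, $B^*=({\alpha^*}'\wedge{\alpha^*}'')/\|{\alpha^*}'\wedge{\alpha^*}''\|$, $N^*=B^*\wedge T^*$, $\kappa^*=\|{\alpha^*}'\wedge{\alpha^*}''\|/\|{\alpha^*}'\|^3$, $\tau^*=\langle{\alpha^*}'\wedge{\alpha^*}'',{\alpha^*}'''\rangle/\|{\alpha^*}'\wedge{\alpha^*}''\|^2$. For real constants $a,b$ put $O^*=\frac{aT^*+bN^*}{\sqrt{a^2+b^2}}$. The curve $\alpha^*$ is called a $B$-$O^*$ associated curve of $\alpha$ if $\alpha^*=\alpha+\lambda B$ for a smooth real function $\lambda$ of $s$ and $B$ is linearly dependent with $O^*$, normalized so that $B=O^*$. *)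

(* Defs.v *)
From HB Require Import structures.
From mathcomp Require Import all_boot all_order all_algebra.
From mathcomp Require Import all_classical all_reals all_analysis.

Set Implicit Arguments.
Unset Strict Implicit.
Unset Printing Implicit Defensive.

Import Order.TTheory GRing.Theory Num.Theory.
Import numFieldNormedType.Exports.

Local Open Scope ring_scope.
Local Open Scope classical_set_scope.

(* The library norm on 'rV[R]_3 is the sup norm; it only serves to define
   derivatives.  The Euclidean structure of E^3 is given by dotv and enorm. *)
Definition dotv (R : realType) (u v : 'rV[R]_3) : R :=
  \sum_(i < 3) u 0 i * v 0 i.

Definition enorm (R : realType) (u : 'rV[R]_3) : R := Num.sqrt (dotv u u).

(* Index arithmetic in 'I_3 is modulo 3. *)
Definition crossv (R : realType) (u v : 'rV[R]_3) : 'rV[R]_3 :=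
  \row_(k < 3) (u 0 (k + 1) * v 0 (k + 2) - u 0 (k + 2) * v 0 (k + 1)).

Definition smooth_on (R : realType) (V : normedModType R) (I : set R)
    (f : R -> V) : Prop :=
  forall (n : nat) (s : R), I s -> derivable (derive1n n f) s 1.

(* The arc_ versions are meant for curves parametrized by arc length; the
   torsion is the B-component of N', as in N' = - kappa T + tau B. *)
Section ArcLength.
Context (R : realType).
Implicit Type alpha : R -> 'rV[R]_3.

Definition unit_speed_on (I : set R) alpha : Prop :=
  forall s, I s -> enorm (derive1 alpha s) = 1.

Definition arcT alpha : R -> 'rV[R]_3 := derive1 alpha.

Definition arc_curvature alpha : R -> R :=
  fun s => enorm (derive1 (arcT alpha) s).

Definition arcN alpha : R -> 'rV[R]_3 :=
  fun s => (arc_curvature alpha s)^-1 *: derive1 (arcT alpha) s.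

Definition arcB alpha : R -> 'rV[R]_3 :=
  fun s => crossv (arcT alpha s) (arcN alpha s).

Definition arc_torsion alpha : R -> R :=
  fun s => dotv (derive1 (arcN alpha) s) (arcB alpha s).

End ArcLength.

(* Valid for a regular curve with any parameter; derivatives are taken with
   respect to that parameter. *)
Section AnyParameter.
Context (R : realType).
Implicit Type gamma : R -> 'rV[R]_3.

Definition frenet_regular_on (I : set R) gamma : Prop :=
  forall s, I s ->
    derive1 gamma s != 0 /\ crossv (derive1 gamma s) (derive1n 2 gamma s) != 0.

Definition tangent gamma : R -> 'rV[R]_3 :=
  fun s => (enorm (derive1 gamma s))^-1 *: derive1 gamma s.

Definition binormal gamma : R -> 'rV[R]_3 :=
  fun s => (enorm (crossv (derive1 gamma s) (derive1n 2 gamma s)))^-1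
           *: crossv (derive1 gamma s) (derive1n 2 gamma s).

Definition principal_normal gamma : R -> 'rV[R]_3 :=
  fun s => crossv (binormal gamma s) (tangent gamma s).

Definition curvature gamma : R -> R :=
  fun s => enorm (crossv (derive1 gamma s) (derive1n 2 gamma s))
           / enorm (derive1 gamma s) ^+ 3.

Definition torsion gamma : R -> R :=
  fun s => dotv (crossv (derive1 gamma s) (derive1n 2 gamma s))
                (derive1n 3 gamma s)
           / enorm (crossv (derive1 gamma s) (derive1n 2 gamma s)) ^+ 2.

Definition osc_vector (a b : R) gamma : R -> 'rV[R]_3 :=
  fun s => (Num.sqrt (a ^+ 2 + b ^+ 2))^-1
           *: (a *: tangent gamma s + b *: principal_normal gamma s).

End AnyParameter.

(* Linear dependence of B and O* is taken in its normalized form B = O*. *)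
Definition BO_associated (R : realType) (I : set R) (a b : R)
    (alpha : R -> 'rV[R]_3) (lambda : R -> R) (alphas : R -> 'rV[R]_3) : Prop :=
  [/\ smooth_on I lambda,
      forall s, I s -> alphas s = alpha s + lambda s *: arcB alpha s
    & forall s, I s -> arcB alpha s = osc_vector a b alphas s].

(* Main.v *)
Require Import Defs.
From HB Require Import structures.
From mathcomp Require Import all_boot all_order all_algebra.
From mathcomp Require Import all_classical all_reals all_analysis.
From mathcomp Require Import ring.

(* In the Frenet frame of alpha, alphas' = (1, - l t, l'), and the frame
   equations give alphas' /\ alphas'' = (X, Y, Z).  As O* lies in the osculating
   plane of alphas, B = O* is orthogonal to alphas' /\ alphas'', hence Z = 0.
   With v = |alphas'|, e = |alphas' /\ alphas''| and c = sqrt (a^2 + b^2), the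
   components of B = O* along T* and N* give l' / v = a / c and
   - (X l t + Y) / (v e) = b / c.  These express both l' and X l t + Y in terms
   of a, b, c, v, e, which turns the claimed formulas into kappa* = e / v^3 and
   tau* = <alphas' /\ alphas'', alphas'''> / e^2. *)

Set Implicit Arguments.
Unset Strict Implicit.
Unset Printing Implicit Defensive.

Import Order.TTheory GRing.Theory Num.Theory.
Import numFieldNormedType.Exports.

Local Open Scope ring_scope.
Local Open Scope classical_set_scope.

(** * Smooth functions on an open set and their closure properties *)

Section SmoothFunctions.
Context (R : realType) (I : set R) (openI : open I).

(** Since [I] is open, agreement on [I] is agreement near [s], and a derivative depends on nothing
    else. *)
Lemma is_derive_eq_on (V : normedModType R) (f g : R -> V) (s : R) (df : V) :
  I s -> (forall x, I x -> f x = g x) ->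
  is_derive s 1 f df -> is_derive s 1 g df.
Proof.
move=> Is fg; apply: near_eq_is_derive.
by apply: filterS (open_nbhs_nbhs (conj openI Is)) => x /fg.
Qed.

Lemma derive1_eq (V : normedModType R) (f : R -> V) (s : R) (df : V) :
  is_derive s 1 f df -> derive1 f s = df.
Proof. by move=> fdf; rewrite derive1E; exact: derive_val. Qed.

Lemma smooth_on_is_derive (V : normedModType R) (f : R -> V) (s : R) :
  smooth_on I f -> I s -> is_derive s 1 f (derive1 f s).
Proof. by move=> /(_ 0%N) fs Is; rewrite derive1E; apply/derivableP/fs. Qed.

Lemma smooth_on_derive1 (V : normedModType R) (f : R -> V) :
  smooth_on I f -> smooth_on I (derive1 f).
Proof. by move=> fs n s Is; rewrite -derive1Sn; exact: fs. Qed.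

(** [P] serves as an invariant: by induction on [n], the [n]-th derivative of [f] agrees on [I] with
    some member of [P], and every member is differentiable there. *)
Lemma smooth_on_coind (V : normedModType R) (P : (R -> V) -> Prop) :
  (forall f, P f ->
    exists2 g, P g & forall s, I s -> is_derive s 1 f (g s)) ->
  forall f, P f -> smooth_on I f.
Proof.
move=> Pd f Pf n.
have [g Pg fg] : exists2 g, P g & forall s, I s -> g s = derive1n n f s.
  elim: n => [|n [g Pg fg]]; first by exists f.
  have [h Ph gh] := Pd _ Pg; exists h => // s Is.
  by apply/esym/derive1_eq/(is_derive_eq_on Is fg)/gh.
have [h _ gh] := Pd _ Pg => s Is.
by have [] := is_derive_eq_on Is fg (gh _ Is).
Qed.

(* Stable under differentiation by construction, so that all the closure
   properties of smooth functions follow from a single coinduction. *)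
Inductive smooth_expr : (R -> R) -> Prop :=
| smooth_expr_base f : smooth_on I f -> smooth_expr f
| smooth_expr_cst c : smooth_expr (fun=> c)
| smooth_exprD f g :
    smooth_expr f -> smooth_expr g -> smooth_expr (fun s => f s + g s)
| smooth_exprM f g :
    smooth_expr f -> smooth_expr g -> smooth_expr (fun s => f s * g s)
| smooth_exprV f :
    (forall s, I s -> f s != 0) -> smooth_expr f ->
    smooth_expr (fun s => (f s)^-1)
| smooth_expr_sqrt f :
    (forall s, I s -> 0 < f s) -> smooth_expr f ->
    smooth_expr (fun s => Num.sqrt (f s)).

(** Induction on the expression: each differentiation rule yields a derivative that is again an
    expression, as the coinduction requires. *)
Lemma smooth_on_expr f : smooth_expr f -> smooth_on I f.
Proof.
apply: smooth_on_coind => {}f; elim=> {f}.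
- move=> f fs; exists (derive1 f).
    by apply: smooth_expr_base; exact: smooth_on_derive1.
  by move=> s; exact: smooth_on_is_derive.
- by move=> c; exists (fun=> 0) => [|s _];
    [exact: smooth_expr_cst|exact: is_derive_cst].
- move=> f g _ [f' f's fd] _ [g' g's gd].
  exists (fun s => f' s + g' s); first exact: smooth_exprD.
  by move=> s Is; apply: is_deriveD; [exact: fd|exact: gd].
- move=> f g fs [f' f's fd] gs [g' g's gd].
  exists (fun s => f s * g' s + g s * f' s).
    by apply: smooth_exprD; apply: smooth_exprM.
  by move=> s Is; apply: is_deriveM; [exact: fd|exact: gd].
- move=> f f0 fs [f' f's fd].
  (* [- f' / f ^+ 2] is spelled with products, inverses and the constant [-1], the shapes for which
     [smooth_expr] has constructors. *)
  exists (fun s => -1 * ((f s)^-1 * (f s)^-1) * f' s).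
    apply: smooth_exprM => //; apply: smooth_exprM.
      exact: smooth_expr_cst.
    by apply: smooth_exprM; exact: smooth_exprV.
  move=> s Is; apply: is_derive_eq (is_deriveV (f0 _ Is) (fd _ Is)) _.
  by rewrite /GRing.scale/= mulN1r expr2 invfM.
- move=> f f0 fs [f' f's fd].
  exists (fun s => (2 * Num.sqrt (f s))^-1 * f' s).
    apply: smooth_exprM => //; apply: smooth_exprV.
      by move=> s Is; rewrite mulf_neq0// gt_eqF// sqrtr_gt0 f0.
    by apply: smooth_exprM; [exact: smooth_expr_cst|exact: smooth_expr_sqrt].
  move=> s Is; apply: (@is_derive1_comp _ Num.sqrt f).
    exact/is_derive1_sqrt/f0.
  exact: fd.
Qed.

Lemma smooth_onD (f g : R -> R) :
  smooth_on I f -> smooth_on I g -> smooth_on I (fun s => f s + g s).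
Proof.
by move=> fs gs; apply/smooth_on_expr/smooth_exprD; exact: smooth_expr_base.
Qed.

Lemma smooth_onM (f g : R -> R) :
  smooth_on I f -> smooth_on I g -> smooth_on I (fun s => f s * g s).
Proof.
by move=> fs gs; apply/smooth_on_expr/smooth_exprM; exact: smooth_expr_base.
Qed.

Lemma smooth_onN (f : R -> R) : smooth_on I f -> smooth_on I (fun s => - f s).
Proof.
move=> fs; have -> : (fun s => - f s) = (fun s => -1 * f s).
  by apply/funext => s; rewrite mulN1r.
apply/smooth_on_expr/smooth_exprM; first exact: smooth_expr_cst.
exact: smooth_expr_base.
Qed.

Lemma smooth_onV (f : R -> R) :
  (forall s, I s -> f s != 0) -> smooth_on I f ->
  smooth_on I (fun s => (f s)^-1).
Proof.
move=> f0 fs; apply/smooth_on_expr/smooth_exprV => //.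
exact: smooth_expr_base.
Qed.

Lemma smooth_on_sqrt (f : R -> R) :
  (forall s, I s -> 0 < f s) -> smooth_on I f ->
  smooth_on I (fun s => Num.sqrt (f s)).
Proof.
move=> f0 fs; apply/smooth_on_expr/smooth_expr_sqrt => //.
exact: smooth_expr_base.
Qed.

End SmoothFunctions.

(** * Scalar and vector products in three-dimensional space *)

Section VectorAlgebra.
Context (R : realType).
Implicit Types u v w : 'rV[R]_3.

(** Splits the abstract index left by [rowP] into the literals [0], [1], [2] that [crossvE]
    matches. *)
Lemma ord3_ind (P : 'I_3 -> Prop) : P 0 -> P 1 -> P 2 -> forall i, P i.
Proof.
move=> P0 P1 P2 [[|[|[|//]]] i3]; [move: P0|move: P1|move: P2];
  by congr P; exact: val_inj.
Qed.

Lemma dotvE u v : dotv u v = u 0 0 * v 0 0 + u 0 1 * v 0 1 + u 0 2 * v 0 2.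
Proof.
rewrite /dotv !big_ord_recl big_ord0 addr0 addrA.
by congr (_ * _ + _ * _ + _ * _); congr (_ 0 _); exact: val_inj.
Qed.

Lemma crossv0E u v : crossv u v 0 0 = u 0 1 * v 0 2 - u 0 2 * v 0 1.
Proof. by rewrite mxE !add0r. Qed.

Lemma crossv1E u v : crossv u v 0 1 = u 0 2 * v 0 0 - u 0 0 * v 0 2.
Proof.
rewrite mxE (_ : 1 + 1 = 2 :> 'I_3); last exact: val_inj.
by rewrite (_ : 1 + 2 = 0 :> 'I_3)//; exact: val_inj.
Qed.

Lemma crossv2E u v : crossv u v 0 2 = u 0 0 * v 0 1 - u 0 1 * v 0 0.
Proof.
rewrite mxE (_ : 2 + 1 = 0 :> 'I_3); last exact: val_inj.
by rewrite (_ : 2 + 2 = 1 :> 'I_3)//; exact: val_inj.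
Qed.

Definition crossvE := (crossv0E, crossv1E, crossv2E).

Lemma dotvDl u v w : dotv (u + v) w = dotv u w + dotv v w.
Proof. by rewrite !dotvE !mxE; ring. Qed.

Lemma dotvZl (c : R) u v : dotv (c *: u) v = c * dotv u v.
Proof. by rewrite !dotvE !mxE; ring. Qed.

Lemma dotvC u v : dotv u v = dotv v u.
Proof. by rewrite !dotvE; ring. Qed.

Lemma dotvDr u v w : dotv u (v + w) = dotv u v + dotv u w.
Proof. by rewrite !(dotvC u) dotvDl. Qed.

Lemma dotvZr (c : R) u v : dotv u (c *: v) = c * dotv u v.
Proof. by rewrite !(dotvC u) dotvZl. Qed.

Lemma crossvC u v : crossv u v = - crossv v u.
Proof.
by apply/rowP; elim/ord3_ind; rewrite [in RHS]mxE !crossvE; ring.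
Qed.

Lemma crossvZl (c : R) u v : crossv (c *: u) v = c *: crossv u v.
Proof.
by apply/rowP; elim/ord3_ind; rewrite [in RHS]mxE !crossvE !mxE; ring.
Qed.

Lemma crossvZr (c : R) u v : crossv u (c *: v) = c *: crossv u v.
Proof. by rewrite crossvC crossvZl -scalerN -crossvC. Qed.

Lemma crossvDl u v w : crossv (u + v) w = crossv u w + crossv v w.
Proof.
by apply/rowP; elim/ord3_ind; rewrite [in RHS]mxE !crossvE !mxE; ring.
Qed.

Lemma crossvDr u v w : crossv u (v + w) = crossv u v + crossv u w.
Proof. by rewrite crossvC crossvDl opprD -!crossvC. Qed.

Lemma crossvv u : crossv u u = 0.
Proof. by apply/rowP; elim/ord3_ind; rewrite crossvE mxE; ring. Qed.

(** The vector triple product expansion, from which the cyclic relations of the Frenet frame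
    follow. *)
Lemma crossvA u v w :
  crossv (crossv u v) w = dotv u w *: v - dotv v w *: u.
Proof.
by apply/rowP; elim/ord3_ind; rewrite !crossvE ![in RHS]mxE !dotvE; ring.
Qed.

Lemma dotv_crossvl u v : dotv (crossv u v) u = 0.
Proof. by rewrite dotvE !crossvE; ring. Qed.

Lemma dotv_crossvr u v : dotv (crossv u v) v = 0.
Proof. by rewrite dotvE !crossvE; ring. Qed.

(** Lagrange's identity; it gives [B] its unit length. *)
Lemma dotv_crossv u v :
  dotv (crossv u v) (crossv u v) = dotv u u * dotv v v - dotv u v ^+ 2.
Proof. by rewrite !dotvE !crossvE; ring. Qed.

(* Cramer's rule for the basis u, v, w. *)
Lemma crossv_basis u v w (x : 'rV[R]_3) :
  dotv (crossv u v) w *: x =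
  dotv x u *: crossv v w + dotv x v *: crossv w u + dotv x w *: crossv u v.
Proof.
(* Coordinates of sums and multiples only: [mxE] also sees through [crossv], whose entries are left
   to [crossvE]. *)
have addE (y z : 'rV[R]_3) i : (y + z) 0 i = y 0 i + z 0 i by rewrite mxE.
have scaleE c (y : 'rV[R]_3) i : (c *: y) 0 i = c * y 0 i by rewrite mxE.
by apply/rowP; elim/ord3_ind; rewrite !addE !scaleE !dotvE !crossvE; ring.
Qed.

Lemma dotv_ge0 u : 0 <= dotv u u.
Proof. by apply: sumr_ge0 => i _; rewrite -expr2 sqr_ge0. Qed.

Lemma sqr_enorm u : enorm u ^+ 2 = dotv u u.
Proof. by rewrite sqr_sqrtr// dotv_ge0. Qed.

Lemma enorm_gt0 u : (0 < enorm u) = (u != 0).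
Proof.
rewrite sqrtr_gt0 lt0r dotv_ge0 andbT; congr (~~ _); apply/eqP/eqP => [u0|->].
  have /psumr_eq0P u0' : dotv u u = 0 by [].
  apply/rowP => i; rewrite mxE; apply/eqP; rewrite -sqrf_eq0 expr2.
  by apply/eqP/u0' => // j _; rewrite -expr2 sqr_ge0.
by rewrite dotvE !mxE; ring.
Qed.

Lemma lincomb3_congr u v w (p q r p' q' r' : R) :
  p = p' -> q = q' -> r = r' ->
  p *: u + q *: v + r *: w = p' *: u + q' *: v + r' *: w.
Proof. by move=> -> -> ->. Qed.

End VectorAlgebra.

(** * Derivatives and smoothness of vector-valued functions *)

Section VectorCalculus.
Context (R : realType).
Implicit Types (u v : R -> 'rV[R]_3) (p : R -> R).

Lemma is_derive_rowP u (s : R) (du : 'rV[R]_3) :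
  is_derive s 1 u du <->
  forall i, is_derive s 1 (fun x => u x 0 i) (du 0 i).
Proof.
split=> [[ud <-] i|ud].
  have /derivable_mxP/(_ 0 i) uid := ud.
  by rewrite derive_mx// mxE; exact/derivableP.
have ud' : derivable u s 1.
  by apply/derivable_mxP => j i; rewrite ord1; have [] := ud i.
apply: DeriveDef => //; rewrite derive_mx//; apply/rowP => i.
by rewrite mxE; have [] := ud i.
Qed.

Lemma is_derive_scale p u (s dp : R) (du : 'rV[R]_3) :
  is_derive s 1 p dp -> is_derive s 1 u du ->
  is_derive s 1 (fun x => p x *: u x) (p s *: du + dp *: u s).
Proof.
move=> pd /is_derive_rowP ud; apply/is_derive_rowP => i.
rewrite (_ : (fun x => _) = p * (fun x => u x 0 i)); last first.
  by apply/funext => x; rewrite mxE.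
apply: is_derive_eq (is_deriveM pd (ud i)) _.
by rewrite !mxE /GRing.scale/= (mulrC dp).
Qed.

Lemma is_derive_dotv u v (s : R) (du dv : 'rV[R]_3) :
  is_derive s 1 u du -> is_derive s 1 v dv ->
  is_derive s 1 (fun x => dotv (u x) (v x)) (dotv (u s) dv + dotv du (v s)).
Proof.
move=> /is_derive_rowP ud /is_derive_rowP vd.
rewrite (_ : (fun x => _) =
    \sum_(i < 3) ((fun x => u x 0 i) * (fun x => v x 0 i))); last first.
  by apply/funext => x; rewrite fct_sumE.
apply: is_derive_eq.
rewrite /dotv -big_split/=; apply: eq_bigr => i _.
by rewrite /GRing.scale/= (mulrC (du 0 i)).
Qed.

Lemma is_derive_crossv u v (s : R) (du dv : 'rV[R]_3) :
  is_derive s 1 u du -> is_derive s 1 v dv ->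
  is_derive s 1 (fun x => crossv (u x) (v x))
    (crossv (u s) dv + crossv du (v s)).
Proof.
move=> /is_derive_rowP ud /is_derive_rowP vd; apply/is_derive_rowP => i.
rewrite (_ : (fun x => _) =
    (fun x => u x 0 (i + 1)) * (fun x => v x 0 (i + 2)) -
    (fun x => u x 0 (i + 2)) * (fun x => v x 0 (i + 1))); last first.
  by apply/funext => x; rewrite mxE.
have d12 := is_deriveM (ud (i + 1)) (vd (i + 2)).
have d21 := is_deriveM (ud (i + 2)) (vd (i + 1)).
apply: is_derive_eq (is_deriveB d12 d21) _.
by rewrite !mxE /GRing.scale/=; ring.
Qed.

Context (I : set R) (openI : open I).

(** Coinduction in both directions: the coordinate functions of smooth curves, and the curves with
    smooth coordinates, are classes closed under differentiation, which acts entrywise. *)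
Lemma smooth_on_rowP u :
  smooth_on I u <-> forall i, smooth_on I (fun s => u s 0 i).
Proof.
split=> [us i|].
  pose P f := exists2 w : R -> 'rV[R]_3, smooth_on I w & f = (fun s => w s 0 i).
  apply: (smooth_on_coind openI (P := P)).
    move=> _ [w ws ->]; exists (fun s => derive1 w s 0 i).
      by exists (derive1 w); [exact: smooth_on_derive1|].
    by move=> s Is; have /is_derive_rowP := smooth_on_is_derive ws Is; apply.
  by exists u.
move: u; apply: (smooth_on_coind openI) => u us.
exists (fun s => \row_i derive1 (fun x => u x 0 i) s) => [i|s Is].
  rewrite (_ : (fun s => _) = derive1 (fun x => u x 0 i)).
    exact: smooth_on_derive1.
  by apply/funext => s; rewrite mxE.
by apply/is_derive_rowP => i; rewrite mxE; exact: smooth_on_is_derive.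
Qed.

Lemma smooth_on_scale p u :
  smooth_on I p -> smooth_on I u -> smooth_on I (fun s => p s *: u s).
Proof.
move=> ps /smooth_on_rowP us; apply/smooth_on_rowP => i.
rewrite (_ : (fun s => _) = (fun s => p s * u s 0 i)).
  exact: (smooth_onM openI ps (us i)).
by apply/funext => s; rewrite mxE.
Qed.

Lemma smooth_on_dotv u v :
  smooth_on I u -> smooth_on I v -> smooth_on I (fun s => dotv (u s) (v s)).
Proof.
move=> /smooth_on_rowP us /smooth_on_rowP vs.
under eq_fun do rewrite dotvE.
have uv i := smooth_onM openI (us i) (vs i).
exact: (smooth_onD openI (smooth_onD openI (uv 0) (uv 1)) (uv 2)).
Qed.

Lemma smooth_on_crossv u v :
  smooth_on I u -> smooth_on I v ->
  smooth_on I (fun s => crossv (u s) (v s)).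
Proof.
move=> /smooth_on_rowP us /smooth_on_rowP vs; apply/smooth_on_rowP => i.
under eq_fun do rewrite mxE.
have uv j j' := smooth_onM openI (us j) (vs j').
exact: (smooth_onD openI (uv _ _) (smooth_onN openI (uv _ _))).
Qed.

End VectorCalculus.

(** * The Frenet frame of a unit speed curve and its equations *)

Section FrenetFrame.
Context (R : realType) (I : set R) (alpha : R -> 'rV[R]_3).
Context (openI : open I) (alphaS : smooth_on I alpha)
  (alpha1 : unit_speed_on I alpha)
  (kappa_gt0 : forall s, I s -> 0 < arc_curvature alpha s).

Local Notation T := (arcT alpha).
Local Notation N := (arcN alpha).
Local Notation B := (arcB alpha).
Local Notation k := (arc_curvature alpha).
Local Notation t := (arc_torsion alpha).

Let kappa_neq0 s : I s -> k s != 0.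
Proof. by move=> /kappa_gt0 /lt0r_neq0. Qed.

Lemma smooth_arcT : smooth_on I T.
Proof. exact: smooth_on_derive1. Qed.

(** Positivity of the curvature keeps the square root away from [0], where it is not
    differentiable. *)
Lemma smooth_arc_curvature : smooth_on I k.
Proof.
have dT := smooth_on_derive1 smooth_arcT.
apply: (smooth_on_sqrt openI) (smooth_on_dotv openI dT dT) => s /kappa_gt0.
by rewrite sqrtr_gt0.
Qed.

Lemma smooth_arcN : smooth_on I N.
Proof.
have Vk := smooth_onV openI kappa_neq0 smooth_arc_curvature.
exact: (smooth_on_scale openI Vk (smooth_on_derive1 smooth_arcT)).
Qed.

Lemma smooth_arcB : smooth_on I B.
Proof. exact: (smooth_on_crossv openI smooth_arcT smooth_arcN). Qed.

Lemma smooth_arc_torsion : smooth_on I t.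
Proof.
exact: (smooth_on_dotv openI (smooth_on_derive1 smooth_arcN) smooth_arcB).
Qed.

Lemma is_derive_arcT s : I s -> is_derive s 1 T (k s *: N s).
Proof.
move=> Is; rewrite scalerA divff ?kappa_neq0// scale1r.
exact: smooth_on_is_derive smooth_arcT Is.
Qed.

Lemma dotv_arcTT s : I s -> dotv (T s) (T s) = 1.
Proof. by move=> Is; rewrite -sqr_enorm alpha1// expr1n. Qed.

Lemma dotv_arcNN s : I s -> dotv (N s) (N s) = 1.
Proof.
move=> Is; rewrite dotvZl dotvZr -sqr_enorm -/(k s).
by field; exact: kappa_neq0.
Qed.

(** Differentiating a constant scalar product; applied to the orthonormality relations, it yields
    the Frenet equations. *)
Lemma dotv_derive_cst (u v : R -> 'rV[R]_3) (c s : R) (du dv : 'rV[R]_3) :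
  (forall x, I x -> dotv (u x) (v x) = c) -> I s ->
  is_derive s 1 u du -> is_derive s 1 v dv ->
  dotv (u s) dv + dotv du (v s) = 0.
Proof.
move=> uvc Is ud vd; rewrite -(derive1_eq (is_derive_dotv ud vd)).
apply: derive1_eq; apply: (is_derive_eq_on openI Is (f := cst c)).
by move=> x Ix; rewrite uvc.
Qed.

Lemma dotv_arcTN s : I s -> dotv (T s) (N s) = 0.
Proof.
move=> Is.
have := dotv_derive_cst dotv_arcTT Is (is_derive_arcT Is) (is_derive_arcT Is).
(* The derivative of [dotv T T = 1] reads [2 k (dotv T N) = 0], and [k] is nonzero. *)
rewrite dotvZr dotvZl (dotvC (N s)) -mulr2n => /eqP.
by rewrite mulrn_eq0/= mulf_eq0 (negbTE (kappa_neq0 Is)) => /eqP.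
Qed.

Lemma dotv_arcBB s : I s -> dotv (B s) (B s) = 1.
Proof.
by move=> Is; rewrite dotv_crossv dotv_arcTT// dotv_arcNN// dotv_arcTN//; ring.
Qed.

Lemma crossv_arcNB s : I s -> crossv (N s) (B s) = T s.
Proof.
move=> Is; rewrite crossvC crossvA dotv_arcTN// dotv_arcNN//.
by rewrite scale0r scale1r sub0r opprK.
Qed.

Lemma crossv_arcBT s : I s -> crossv (B s) (T s) = N s.
Proof.
move=> Is; rewrite crossvA dotv_arcTT// dotvC dotv_arcTN//.
by rewrite scale0r scale1r subr0.
Qed.

(** Cramer's rule in the basis [T], [N], [B], of determinant [dotv B B = 1]: the [T]-component comes
    from differentiating [dotv T N = 0], the [N]-component from [dotv N N = 1], and the
    [B]-component is the torsion by definition. *)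
Lemma is_derive_arcN s : I s -> is_derive s 1 N (- k s *: T s + t s *: B s).
Proof.
move=> Is; have dN := smooth_on_is_derive smooth_arcN Is.
apply: is_derive_eq (dN) _.
have := crossv_basis (T s) (N s) (B s) (derive1 N s).
rewrite crossv_arcNB// crossv_arcBT// dotv_arcBB// scale1r => ->.
have := dotv_derive_cst dotv_arcTN Is (is_derive_arcT Is) dN.
rewrite dotvZl dotv_arcNN// mulr1 dotvC => /eqP; rewrite addr_eq0 => /eqP ->.
have := dotv_derive_cst dotv_arcNN Is dN dN.
rewrite dotvC -mulr2n => /eqP; rewrite mulrn_eq0/= => /eqP ->.
by rewrite scale0r addr0.
Qed.

(** In the product rule for [crossv T N] only the term [t] times [crossv T B] survives, and
    [crossv T B] is [- N]. *)
Lemma is_derive_arcB s : I s -> is_derive s 1 B (- t s *: N s).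
Proof.
move=> Is.
have dB := is_derive_crossv (is_derive_arcT Is) (is_derive_arcN Is).
apply: is_derive_eq (dB) _.
rewrite crossvDr crossvZl crossvv (crossvZr (t s)) crossvZr crossvv.
rewrite !scaler0 add0r addr0.
by rewrite crossvC crossv_arcBT// scaleNr scalerN.
Qed.

Definition frame_comb (p q r : R -> R) (s : R) : 'rV[R]_3 :=
  p s *: T s + q s *: N s + r s *: B s.

(** The product rule with the Frenet equations: coordinates are differentiated and corrected by the
    skew-symmetric Frenet matrix. *)
Lemma is_derive_frame_comb (p q r : R -> R) (s dp dq dr : R) : I s ->
  is_derive s 1 p dp -> is_derive s 1 q dq -> is_derive s 1 r dr ->
  is_derive s 1 (frame_comb p q r)
    ((dp - k s * q s) *: T s + (dq + k s * p s - t s * r s) *: N s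
     + (dr + t s * q s) *: B s).
Proof.
move=> Is pd qd rd.
have dT := is_derive_scale pd (is_derive_arcT Is).
have dN := is_derive_scale qd (is_derive_arcN Is).
have dB := is_derive_scale rd (is_derive_arcB Is).
apply: is_derive_eq (is_deriveD (is_deriveD dT dN) dB) _.
move: (T s) (N s) (B s) => e1 e2 e3.
by apply/rowP => i; rewrite !mxE; ring.
Qed.

Lemma dotv_frame_comb s (p q r p' q' r' : R) : I s ->
  dotv (p *: T s + q *: N s + r *: B s) (p' *: T s + q' *: N s + r' *: B s)
  = p * p' + q * q' + r * r'.
Proof.
move=> Is; have TB : dotv (B s) (T s) = 0 by exact: dotv_crossvl.
have NB : dotv (B s) (N s) = 0 by exact: dotv_crossvr.
move: (dotv_arcTT Is) (dotv_arcNN Is) (dotv_arcBB Is) (dotv_arcTN Is) TB NB.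
move: (T s) (N s) (B s) => e1 e2 e3 e11 e22 e33 e12 e31 e32.
rewrite !(dotvDl, dotvDr, dotvZl, dotvZr) e11 e22 e33 e12 e31 e32.
by rewrite (dotvC e2) e12 (dotvC e1) e31 (dotvC e2) e32; ring.
Qed.

Lemma dotv_arcB_frame_comb s (p q r : R) : I s ->
  dotv (B s) (p *: T s + q *: N s + r *: B s) = r.
Proof.
move=> Is; have {1}-> : B s = 0 *: T s + 0 *: N s + 1 *: B s.
  by rewrite !scale0r scale1r !add0r.
by rewrite dotv_frame_comb//; ring.
Qed.

Lemma crossv_frame_comb s (p q r p' q' r' : R) : I s ->
  crossv (p *: T s + q *: N s + r *: B s) (p' *: T s + q' *: N s + r' *: B s)
  = (q * r' - r * q') *: T s + (r * p' - p * r') *: N s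
    + (p * q' - q * p') *: B s.
Proof.
move=> Is; have TN : crossv (T s) (N s) = B s by [].
move: (crossv_arcNB Is) (crossv_arcBT Is) TN.
move: (T s) (N s) (B s) => e1 e2 e3 e23 e31 e12.
rewrite !(crossvDl, crossvDr, crossvZl, crossvZr) !crossvv.
rewrite (crossvC e2 e1) (crossvC e3 e2) (crossvC e1 e3) e12 e23 e31.
by apply/rowP => i; rewrite !mxE; ring.
Qed.

End FrenetFrame.

(** * The vector [O*] of a regular curve and its scalar products *)

Section OsculatingVector.
Context (R : realType) (a b : R) (gamma : R -> 'rV[R]_3) (s : R).
Context (ab : ~ (a = 0 /\ b = 0)) (dgamma : derive1 gamma s != 0)
  (ddgamma : crossv (derive1 gamma s) (derive1n 2 gamma s) != 0).

Let v := enorm (derive1 gamma s).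
Let C := crossv (derive1 gamma s) (derive1n 2 gamma s).
Let c := Num.sqrt (a ^+ 2 + b ^+ 2).

Lemma sqrt_sqrD_gt0 : 0 < c.
Proof.
rewrite sqrtr_gt0 lt0r addr_ge0 ?sqr_ge0// andbT.
rewrite paddr_eq0 ?sqr_ge0// !sqrf_eq0.
by apply/negP => /andP[/eqP a0 /eqP b0]; apply: ab.
Qed.

(** Collecting the norms in one factor leaves a combination of two orthogonal vectors, so that the
    scalar products below need no further normalization. *)
Lemma osc_vectorE :
  osc_vector a b gamma s =
  (c * v * enorm C)^-1 *:
  ((a * enorm C) *: derive1 gamma s + b *: crossv C (derive1 gamma s)).
Proof.
have v0 : v != 0 by rewrite gt_eqF// enorm_gt0.
have e0 : enorm C != 0 by rewrite gt_eqF// enorm_gt0.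
have c0 : c != 0 by rewrite gt_eqF// sqrt_sqrD_gt0.
rewrite /osc_vector /principal_normal /binormal /tangent -/v -/C -/c.
rewrite crossvZl crossvZr !scalerDr !scalerA.
by congr (_ *: _ + _ *: _); field; rewrite v0 e0 c0.
Qed.

Lemma dotv_osc_vector_derive1 :
  dotv (osc_vector a b gamma s) (derive1 gamma s) = a * v / c.
Proof.
have v0 : v != 0 by rewrite gt_eqF// enorm_gt0.
have e0 : enorm C != 0 by rewrite gt_eqF// enorm_gt0.
have c0 : c != 0 by rewrite gt_eqF// sqrt_sqrD_gt0.
rewrite osc_vectorE dotvZl dotvDl !dotvZl dotv_crossvr -sqr_enorm -/v.
by field; rewrite v0 e0 c0.
Qed.

Lemma dotv_osc_vector_crossv : dotv (osc_vector a b gamma s) C = 0.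
Proof.
rewrite osc_vectorE dotvZl dotvDl !dotvZl dotv_crossvl dotvC dotv_crossvl.
by rewrite !mulr0 addr0 mulr0.
Qed.

(** [crossv C (derive1 gamma s)] is [v * enorm C] times the principal normal, along which [O*] has
    component [b / c]. *)
Lemma dotv_osc_vector_crossv_derive1 :
  dotv (osc_vector a b gamma s) (crossv C (derive1 gamma s)) =
  b * v * enorm C / c.
Proof.
have v0 : v != 0 by rewrite gt_eqF// enorm_gt0.
have e0 : enorm C != 0 by rewrite gt_eqF// enorm_gt0.
have c0 : c != 0 by rewrite gt_eqF// sqrt_sqrD_gt0.
rewrite osc_vectorE dotvZl dotvDl !dotvZl (dotvC (derive1 gamma s)).
rewrite dotv_crossvr dotv_crossv dotv_crossvl -!sqr_enorm -/v.
by field; rewrite v0 e0 c0.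
Qed.

End OsculatingVector.

(** * Curvature and torsion of the associated curve *)

Theorem theorem5p2 (R : realType) (I : set R) (a b : R)
    (alpha alphas : R -> 'rV[R]_3) (lambda : R -> R) :
  open I -> is_interval I ->
  smooth_on I alpha -> unit_speed_on I alpha ->
  (forall s, I s -> 0 < arc_curvature alpha s) ->
  ~ (a = 0 /\ b = 0) ->
  frenet_regular_on I alphas ->
  BO_associated I a b alpha lambda alphas ->
  let k : R -> R := arc_curvature alpha in
  let k' : R -> R := derive1 k in
  let t : R -> R := arc_torsion alpha in
  let t' : R -> R := derive1 t in
  let t'' : R -> R := derive1n 2 t in
  let l : R -> R := lambda in
  let l' : R -> R := derive1 l in
  let l'' : R -> R := derive1n 2 l in
  forall s, I s ->
  let X : R := - l s * t s * (- l s * t s ^+ 2 + l'' s)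
           - l' s * (- l s * t' s - 2 * l' s * t s + k s) in
  let Y : R := l s * t s ^+ 2 - l'' s + l' s * l s * t s * k s in
  let dk : R := l' s ^+ 4 * b * (a ^+ 2 + b ^+ 2)
                * Num.sqrt (a ^+ 2 + b ^+ 2) in
  let dt : R := a ^+ 2 * (X * l s * t s + Y) ^+ 2 in
  (dk != 0 ->
   curvature alphas s = - (a ^+ 4 * (X * l s * t s + Y) / dk)) /\
  (dt != 0 ->
   torsion alphas s =
     b ^+ 2 * l' s ^+ 2 / dt
     * (X * (l s * t s * k' s + 3 * l' s * t s * k s
             + 2 * l s * t' s * k s - k s ^+ 2)
        + Y * (l s * t s ^+ 3 + l s * t s * k s ^+ 2 - l s * t'' s
               - 3 * l' s * t' s - 3 * l'' s * t s + k' s))).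
Proof.
move=> oI _ aS a1 k0 ab reg [lS alE BO] k k' t t' t'' l l' l'' s Is X Y dk dt.
(* Coordinates in the frame of [alpha]: [x1], [x2], [l'] for the first derivative of [alphas], and
   [y1], [y2], [y3] for the second. *)
pose x1 : R -> R := fun=> 1.
pose x2 : R -> R := fun x => - l x * t x.
pose y1 : R -> R := fun x => l x * t x * k x.
pose y2 : R -> R := fun x => k x - 2 * l' x * t x - l x * t' x.
pose y3 : R -> R := fun x => l'' x - l x * t x ^+ 2.
have kS : smooth_on I k := smooth_arc_curvature oI aS k0.
have tS : smooth_on I t := smooth_arc_torsion oI aS k0.
have l'S : smooth_on I l' := smooth_on_derive1 lS.
have dk_ x : I x -> is_derive x 1 k (k' x) by exact: (smooth_on_is_derive kS).
have dt_ x : I x -> is_derive x 1 t (t' x) by exact: (smooth_on_is_derive tS).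
have dt'_ x : I x -> is_derive x 1 t' (t'' x).
  exact: (smooth_on_is_derive (smooth_on_derive1 tS)).
have dl_ x : I x -> is_derive x 1 l (l' x) by exact: (smooth_on_is_derive lS).
have dl'_ x : I x -> is_derive x 1 l' (l'' x).
  exact: (smooth_on_is_derive l'S).
have dl''_ x : I x -> is_derive x 1 l'' (derive1 l'' x).
  exact: (smooth_on_is_derive (smooth_on_derive1 l'S)).
have d1 x : I x -> derive1 alphas x = frame_comb alpha x1 x2 l' x.
  move=> Ix; apply: derive1_eq.
  apply: (is_derive_eq_on oI Ix (fun x Ix => esym (alE x Ix))).
  have dB := is_derive_scale (dl_ x Ix) (is_derive_arcB oI aS a1 k0 Ix).
  apply: is_derive_eq (is_deriveD (smooth_on_is_derive aS Ix) dB) _.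
  rewrite /frame_comb /x1 /x2 scale1r -/(arcT alpha) scalerA mulrN mulNr.
  by rewrite addrA.
have d2 x : I x -> derive1n 2 alphas x = frame_comb alpha y1 y2 y3 x.
  move=> Ix; apply: derive1_eq.
  apply: (is_derive_eq_on oI Ix (fun x Ix => esym (d1 x Ix))).
  have dx2 := is_deriveM (is_deriveN (dl_ x Ix)) (dt_ x Ix).
  have dx1 : is_derive x 1 x1 0 := is_derive_cst _ _ _.
  have d := is_derive_frame_comb oI aS a1 k0 Ix dx1 dx2 (dl'_ x Ix).
  apply: is_derive_eq (d) _.
  rewrite /frame_comb /x1 /x2 /y1 /y2 /y3 -/k -/t /GRing.scale/=.
  by apply: lincomb3_congr; rewrite !fctE /GRing.scale/=; ring.
(* The [B]-coordinate [z] can stay implicit: in the torsion it is multiplied by the [B]-coordinate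
   of [alphas' /\ alphas''], which is [0]. *)
have [z d3] : exists z, derive1n 3 alphas s =
    (l s * t s * k' s + 3 * l' s * t s * k s + 2 * l s * t' s * k s - k s ^+ 2)
      *: arcT alpha s
    + (l s * t s ^+ 3 + l s * t s * k s ^+ 2 - l s * t'' s
       - 3 * l' s * t' s - 3 * l'' s * t s + k' s) *: arcN alpha s
    + z *: arcB alpha s.
  have dlt := is_deriveM (dl_ s Is) (dt_ s Is).
  have dlt' := is_deriveM (dl_ s Is) (dt'_ s Is).
  have dl't := is_deriveM (dl'_ s Is) (dt_ s Is).
  have d2l't := is_deriveD dl't dl't.
  have dtt := is_deriveM (dt_ s Is) (dt_ s Is).
  have dy1 := is_deriveM dlt (dk_ s Is).
  have dy2 := is_deriveB (is_deriveB (dk_ s Is) d2l't) dlt'.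
  have dy3 := is_deriveB (dl''_ s Is) (is_deriveM (dl_ s Is) dtt).
  have d := is_derive_frame_comb oI aS a1 k0 Is dy1 dy2 dy3.
  eexists; apply: derive1_eq.
  apply: (is_derive_eq_on oI Is (f := frame_comb alpha y1 y2 y3)).
    by move=> x /d2.
  (* The rules were assembled for [l' * t + l' * t] and [t * t] in place of [2 * l' * t] and
     [t ^+ 2]; the two curves agree on [I]. *)
  apply: (is_derive_eq_on oI Is _ (is_derive_eq d _)).
    move=> x Ix; rewrite /frame_comb; apply: lincomb3_congr.
    - by [].
    - by rewrite /y2 !fctE /GRing.scale/=; ring.
    - by rewrite /y3 !fctE.
  (* Here [reflexivity] instantiates [z]. *)
  rewrite -/k -/t; apply: lincomb3_congr; last reflexivity.
  - by rewrite !fctE /GRing.scale/=; ring.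
  - by rewrite !fctE /GRing.scale/=; ring.
have [r0 r1] := reg s Is.
have v0 := r0; have e0 := r1; have c0 := sqrt_sqrD_gt0 ab.
rewrite -enorm_gt0 in v0; rewrite -enorm_gt0 in e0.
have CE : crossv (derive1 alphas s) (derive1n 2 alphas s) =
    X *: arcT alpha s + Y *: arcN alpha s
    + (x1 s * y2 s - x2 s * y1 s) *: arcB alpha s.
  rewrite d1// d2// (crossv_frame_comb oI aS a1 k0)//.
  by apply: lincomb3_congr; rewrite /X /Y /x1 /x2 /y1 /y2 /y3; ring.
have dotvB p q r := dotv_arcB_frame_comb oI aS a1 k0 p q r Is.
have HT := dotv_osc_vector_derive1 ab r0 r1.
have HC := dotv_osc_vector_crossv ab r0 r1.
have HN := dotv_osc_vector_crossv_derive1 ab r0 r1.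
(* Once [B] replaces [O*], the three scalar products are [B]-coordinates: [l'] in [HT], that of
   [alphas' /\ alphas''] in [HC], and [X * x2 - Y * x1] in [HN]. *)
rewrite -BO// {1}d1// dotvB in HT.
rewrite -BO// CE dotvB in HC.
rewrite -BO// {1}CE {1}d1// (crossv_frame_comb oI aS a1 k0)// dotvB in HN.
(* Only the vector product in the numerator of the torsion is expanded; the others stay inside the
   norm [e]. *)
rewrite /curvature /torsion {2}CE d3 (dotv_frame_comb oI aS a1 k0)//.
rewrite HC mul0r addr0.
move: HT HN v0 e0 c0.
set v := enorm _; set e := enorm _; set c := Num.sqrt _.
move=> HT HN v0 e0 c0.
have D : X * l s * t s + Y = - (b * v * e / c) by rewrite -HN /x1 /x2; ring.
have c2 : a ^+ 2 + b ^+ 2 = c ^+ 2.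
  by rewrite sqr_sqrtr// addr_ge0// sqr_ge0.
have [v_neq0 e_neq0 c_neq0] : [/\ v != 0, e != 0 & c != 0].
  by split; exact: lt0r_neq0.
rewrite /dk /dt D -/c c2; split=> [dk0|dt0].
  (* [dk] contains the factors [l' = a * v / c] and [b], so neither [a] nor [b] vanishes. *)
  have a0 : a != 0.
    by apply: contraNneq dk0 => a0; rewrite HT a0 !mul0r expr0n/= !mul0r.
  have b0 : b != 0.
    by apply: contraNneq dk0 => b0; rewrite b0 mulr0 !mul0r.
  by rewrite HT; field; rewrite v_neq0 c_neq0 a0 b0.
have a0 : a != 0.
  by apply: contraNneq dt0 => a0; rewrite a0 expr0n/= mul0r.
(* By [D], [b] is a factor of [X * l * t + Y], hence of [dt]. *)
have b0 : b != 0.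
  by apply: contraNneq dt0 => b0; rewrite b0 !mul0r oppr0 expr0n/= mulr0.
(* Both sides share the long bracket; what remains is that the prefactor equals [e ^- 2]. *)
rewrite mulrC; congr (_ * _).
by rewrite HT; field; rewrite v_neq0 e_neq0 c_neq0 a0 b0.
Qed.
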